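(* Let $a\in(0,1)$. The discrete $z^{2a}$ is isomonodromic: for a proper choice of $A(\boldsymbol{0};\lambda)$, the matrices $A(\boldsymbol{n};\lambda)$ at any point $\boldsymbol{n}\in(\mathbb{Z}_+)^d$ have simple poles only: $$A(\boldsymbol{n};\lambda)=\frac{A^{(0)}(\boldsymbol{n})}{\lambda}+\sum_{l=1}^d\frac{B^{(l)}(\boldsymbol{n})}{\lambda-\theta_l^{-2}},$$ with $$A^{(0)}(\boldsymbol{n})=\begin{pmatrix}-a/2&-az(\boldsymbol{n})\\0&a/2\end{pmatrix},$$ $$B^{(l)}(\boldsymbol{n})=\frac{n_l}{z(\boldsymbol{n}+\boldsymbol{e}_l)-z(\boldsymbol{n}-\boldsymbol{e}_l)}\begin{pmatrix}z(\boldsymbol{n}+\boldsymbol{e}_l)-z(\boldsymbol{n})&(z(\boldsymbol{n}+\boldsymbol{e}_l)-z(\boldsymbol{n}))(z(\boldsymbol{n})-z(\boldsymbol{n}-\boldsymbol{e}_l))\\1&z(\boldsymbol{n})-z(\boldsymbol{n}-\boldsymbol{e}_l)\end{pmatrix}.$$ At any point $\boldsymbol{n}\in\widetilde{S}$, the discrete $z^{2a}$ satisfies the constraint $$\sum_{j=1}^dn_j\,\frac{(z(\boldsymbol{n}+\boldsymbol{e}_j)-z(\boldsymbol{n}))(z(\boldsymbol{n})-z(\boldsymbol{n}-\boldsymbol{e}_j))}{z(\boldsymbol{n}+\boldsymbol{e}_j)-z(\boldsymbol{n}-\boldsymbol{e}_j)}=a\,z(\boldsymbol{n}).$$ (Terms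 with $n_l=0$, resp. $n_j=0$, are understood to vanish; it is assumed that $z$ is well defined and finite and the denominators that occur are non-zero.)
   Context: Let $\theta_1,\ldots,\theta_d\in\mathbb{S}^1$ be such that $\theta_1,\ldots,\theta_d,-\theta_1,\ldots,-\theta_d$ are distinct and occur in this circular (counterclockwise) order on the unit circle. Put $\theta_{k+d}=-\theta_k$ and extend $\theta_r$ to $r\in\mathbb{Z}$ by $2d$-periodicity. Choose $\gamma_r\in\mathbb{R}$ with $\theta_r=\exp(i\gamma_r)$, $\gamma_{r+1}-\gamma_r\in(0,\pi)$, and set $\log\theta_r=i\gamma_r$. Let $\boldsymbol{e}_1,\ldots,\boldsymbol{e}_d$ be the unit vectors of $\mathbb{Z}^d$, $\boldsymbol{e}_{k+d}=-\boldsymbol{e}_k$, extended by $2d$-periodicity. $S_m$ is the octant of $\boldsymbol{n}=\sum_{r=m}^{m+d-1}n_r\boldsymbol{e}_r$ with integers $n_r\ge0$ (so $S_1=(\mathbb{Z}_+)^d$); $\widetilde{S}_m$ is $S_m$ equipped with the values $\log\theta_r=i\gamma_r$, $r\in[m,m+d-1]$; $\widetilde{S}=\bigcup_m\widetilde{S}_m$, glued along common semi-axes with matching $\log\theta_r$. In the constraint, $n_1,\dots,n_d$ are the coordinates of the underlying point of $\mathbb{Z}^d$, and the points $\boldsymbol{n}\pm\boldsymbol{e}_j$ with $n_j\neq0$ are taken in the same $\widetilde{S}_m$ as $\boldsymbol{n}$. The discrete $z^{2a}$ is the solution $z$ on $\widetilde{S}$ of the cross-ratio system $$\frac{(z(\boldsymbol{n})-z(\boldsymbol{n}+\boldsymbol{e}_j))(z(\boldsymbol{n}+\boldsymbol{e}_j+\boldsymbol{e}_k)-z(\boldsymbol{n}+\boldsymbol{e}_k))}{(z(\boldsymbol{n}+\boldsymbol{e}_j)-z(\boldsymbol{n}+\boldsymbol{e}_j+\boldsymbol{e}_k))(z(\boldsymbol{n}+\boldsymbol{e}_k)-z(\boldsymbol{n}))}=\frac{\theta_j^2}{\theta_k^2}$$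 (on each $\widetilde{S}_m$, $j\neq k$ in $[m,m+d-1]$) defined by the values on the coordinate semi-axes $z_n=z(n\boldsymbol{e}_r)$, $r\in[m,m+d-1]$, which solve $n\,\frac{(z_{n+1}-z_n)(z_n-z_{n-1})}{z_{n+1}-z_{n-1}}=az_n$ ($n\ge1$) with $z_0=z(\boldsymbol{0})=0$, $z_1=z(\boldsymbol{e}_r)=\theta_r^{2a}=\exp(2a\log\theta_r)$. Transition matrices: $L_k(\boldsymbol{n};\lambda)=\begin{pmatrix}1&z(\boldsymbol{n})-z(\boldsymbol{n}+\boldsymbol{e}_k)\\ \lambda\theta_k^2\,(z(\boldsymbol{n})-z(\boldsymbol{n}+\boldsymbol{e}_k))^{-1}&1\end{pmatrix}$. The matrices $A(\boldsymbol{n};\lambda)$ are determined by a choice of $A(\boldsymbol{0};\lambda)$ and the (consistent) recurrence $A(\boldsymbol{n}+\boldsymbol{e}_k;\lambda)=\frac{dL_k(\boldsymbol{n};\lambda)}{d\lambda}L_k^{-1}(\boldsymbol{n};\lambda)+L_k(\boldsymbol{n};\lambda)A(\boldsymbol{n};\lambda)L_k^{-1}(\boldsymbol{n};\lambda)$. Isomonodromic means that, for some choice of $A(\boldsymbol{0};\lambda)$, the matrices $A(\boldsymbol{n};\lambda)$ are meromorphic in $\lambda$ with poles whose positions and orders do not depend on $\boldsymbol{n}$. $\mathbb{Z}_+$ denotes the non-negative integers. *)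

(* Defs.v *)
From HB Require Import structures.
From mathcomp Require Import all_boot all_order all_algebra.
From mathcomp Require Import complex.
From mathcomp Require Import all_classical all_reals all_analysis.

Set Implicit Arguments.
Unset Strict Implicit.
Unset Printing Implicit Defensive.

Import Order.TTheory GRing.Theory Num.Theory.
Import numFieldNormedType.Exports.

Local Open Scope classical_set_scope.
Local Open Scope ring_scope.
Local Open Scope complex_scope.

(* Indices are shifted to start at 0: the directions theta_1, ..., theta_d and
   unit vectors e_1, ..., e_d are theta 0, ..., theta (d - 1) and
   unit_vec d 0, ..., unit_vec d (d - 1), and S_1 = (Z_+)^d is the octant of
   index 0.  The case d = 0 is excluded by [dir_antipodal], and d = 1 by
   [dir_antipodal] together with [dir_gamma_step]. *)

Definition expi (R : realType) (t : R) : R[i] := cos t +i* sin t.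

Definition mat2 (K : Type) (a b c d : K) : 'M[K]_2 :=
  \matrix_(i < 2, j < 2)
    if i == 0 then (if j == 0 then a else b) else (if j == 0 then c else d).

(* e_r for all integers r, with e_(r + d) = - e_r. *)
Definition unit_vec (d : nat) (r : int) : 'rV[int]_d :=
  \row_(i < d) if (r %% d)%Z == i%:Z then (-1) ^ (r %/ d)%Z else 0.

Definition in_octant (d : nat) (m : int) (n : 'rV[int]_d) : Prop :=
  exists c : 'I_d -> nat, n = \sum_(i < d) unit_vec d (m + i%:Z) *+ c i.

Record directions (R : realType) (d : nat) (theta : int -> R[i])
    (gamma : int -> R) : Prop := Directions {
  (* theta_0, ..., theta_(d-1), - theta_0, ..., - theta_(d-1) are distinct
     points of the unit circle in counterclockwise order *)
  dir_ccw : exists alpha : nat -> R,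
    [/\ forall k, (k < d.*2)%N -> theta k%:Z = expi (alpha k),
        forall k l, (k < l)%N -> (l < d.*2)%N -> alpha k < alpha l &
        forall k, (k < d.*2)%N -> alpha k < alpha 0%N + 2 * pi];
  dir_antipodal : forall r : int, theta (r + d%:Z) = - theta r;
  dir_gamma : forall r : int, theta r = expi (gamma r);
  dir_gamma_step : forall r : int, 0 < gamma (r + 1) - gamma r < pi }.

(* A function on the branched covering (the union of the sheets over the
   octants of index m, for all integers m) is given by its values z m n at the
   point of the m-th sheet that lies over n, for n in the octant of index m;
   values of z m outside this octant are irrelevant.  The sheets m and m' are
   glued along the semi-axes of those e_r with r in both [m, m + d - 1] and
   [m', m' + d - 1] (equality of indices r, not just of the vectors e_r). *)
Record discrete_power (R : realType) (d : nat) (theta : int -> R[i])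
    (gamma : int -> R) (a : R) (z : int -> 'rV[int]_d -> R[i]) : Prop :=
  DiscretePower {
  dp_glue : forall (m m' r : int) (k : nat),
    m <= r < m + d%:Z -> m' <= r < m' + d%:Z ->
    z m (unit_vec d r *+ k) = z m' (unit_vec d r *+ k);
  dp_origin : forall m : int, z m 0 = 0;
  dp_first : forall m r : int, m <= r < m + d%:Z ->
    z m (unit_vec d r) = expi (2 * a * gamma r);
  dp_axis : forall (m r : int) (k : nat), m <= r < m + d%:Z -> (0 < k)%N ->
    let zk j := z m (unit_vec d r *+ j) in
    k%:R * ((zk k.+1 - zk k) * (zk k - zk k.-1) / (zk k.+1 - zk k.-1))
    = a%:C * zk k;
  dp_cross_ratio : forall (m j k : int) (n : 'rV[int]_d),
    in_octant m n ->
    m <= j < m + d%:Z -> m <= k < m + d%:Z -> j != k ->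
    let ej := unit_vec d j in let ek := unit_vec d k in
    ((z m n - z m (n + ej)) * (z m (n + ej + ek) - z m (n + ek)))
    / ((z m (n + ej) - z m (n + ej + ek)) * (z m (n + ek) - z m n))
    = theta j ^+ 2 / theta k ^+ 2 }.

(* The denominators that occur: differences along edges, and differences
   across two consecutive edges of the same direction. *)
Definition nonzero_denominators (R : realType) (d : nat)
    (z : int -> 'rV[int]_d -> R[i]) : Prop :=
  forall (m r : int) (n : 'rV[int]_d), in_octant m n -> m <= r < m + d%:Z ->
    let e := unit_vec d r in
    z m (n + e) != z m n /\ z m (n + e + e) != z m n.

Definition transition_mx (R : realType) (d : nat) (theta : int -> R[i])
    (z : 'rV[int]_d -> R[i]) (k : int) (n : 'rV[int]_d) (l : R[i]) :
    'M[R[i]]_2 :=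
  let u := z n - z (n + unit_vec d k) in
  mat2 1 u (l * theta k ^+ 2 * u^-1) 1.

(* The recurrence is an identity between meromorphic functions of l: it is
   required near every point, except possibly at the point itself.  Here z is
   the restriction to the octant of index 0. *)
Definition monodromy_system (R : realType) (d : nat) (theta : int -> R[i])
    (z : 'rV[int]_d -> R[i]) (A : 'rV[int]_d -> R[i] -> 'M[R[i]]_2) : Prop :=
  forall (n : 'rV[int]_d) (k : 'I_d) (p : R[i]^o), in_octant 0 n ->
    \forall l \near p^',
      let L := transition_mx theta z k%:Z n in
      A (n + unit_vec d k%:Z) l
      = L^`()%classic l *m invmx (L l) + L l *m A n l *m invmx (L l).

(* F is meromorphic at p, with a pole of order exactly k if k > 0, and with at
   most a removable singularity if k = 0. *)
Definition pole_order (R : realType) (F : R[i] -> 'M[R[i]]_2) (p : R[i]^o)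
    (k : nat) : Prop :=
  exists G : R[i]^o -> 'M[R[i]]_2,
    [/\ \forall l \near p, derivable G l 1,
        (0 < k)%N -> G p != 0 &
        \forall l \near p^', F l = (l - p) ^- k *: G l].

Definition isomonodromic (R : realType) (d : nat) (theta : int -> R[i])
    (z : 'rV[int]_d -> R[i]) : Prop :=
  exists2 A : 'rV[int]_d -> R[i] -> 'M[R[i]]_2,
    monodromy_system theta z A &
    exists ord : R[i] -> nat, forall (n : 'rV[int]_d) (p : R[i]),
      in_octant 0 n -> pole_order (A n) p (ord p).

Definition residue0 (R : realType) (d : nat) (a : R)
    (z : 'rV[int]_d -> R[i]) (n : 'rV[int]_d) : 'M[R[i]]_2 :=
  mat2 (- (a%:C / 2)) (- (a%:C * z n)) 0 (a%:C / 2).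

(* If n_l = 0, the factor n_l makes the matrix vanish, whatever the values of z
   at n - e_l, which is then outside the octant. *)
Definition residue (R : realType) (d : nat) (z : 'rV[int]_d -> R[i])
    (l : 'I_d) (n : 'rV[int]_d) : 'M[R[i]]_2 :=
  let zp := z (n + unit_vec d l%:Z) in
  let zm := z (n - unit_vec d l%:Z) in
  ((n 0 l)%:~R / (zp - zm)) *:
    mat2 (zp - z n) ((zp - z n) * (z n - zm)) 1 (z n - zm).

(* Main.v *)
(** Write A(n; l) for the matrix with the prescribed residues. At every pole,
    A(n + e_k) L_k and L_k A(n) have the same residue: for the poles
    theta_j^-2 with j <> k this is the cross-ratio equation (L_k acts on the
    residue, a multiple of a projector, by a Moebius map), while at theta_k^-2
    both sides vanish. So the recurrence A(n + e_k) L_k = L_k' + L_k A(n) can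
    fail only by a matrix independent of l, which vanishes when the constraint
    holds at n and n + e_k, and a scalar relation between the diagonals of the
    residue sums at n and n + e_k holds.  On the semi-axes both follow from the
    equation for z_n.  Around an elementary square, the two routes to the
    opposite vertex give the same matrix, which propagates both properties to
    the whole octant.

    The residue at theta_j^-2 vanishes where n_j = 0, so that matrix itself does
    not have pole orders independent of n; adding the scalar function
    sum_j 1 / (l - theta_j^-2), which preserves the recurrence, repairs this. *)
Require Import Defs.
From HB Require Import structures.
From mathcomp Require Import all_boot all_order all_algebra.
From mathcomp Require Import complex.
From mathcomp Require Import ring lra.
From mathcomp Require Import all_classical all_reals all_analysis.

Set Implicit Arguments.
Unset Strict Implicit.
Unset Printing Implicit Defensive.

Import Order.TTheory GRing.Theory Num.Theory.
Import numFieldNormedType.Exports.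

Local Open Scope classical_set_scope.
Local Open Scope ring_scope.
Local Open Scope complex_scope.

(** * Two-by-two matrices *)

Lemma mat2E (K : Type) (A : 'M[K]_2) : A = mat2 (A 0 0) (A 0 1) (A 1 0) (A 1 1).
Proof.
apply/matrixP => i j; rewrite mxE.
by case: i => [[|[|//]] ?]; case: j => [[|[|//]] ?] /=; congr (A _ _);
  apply/val_inj.
Qed.

Lemma mat2_entries (K : Type) (a b c d : K) :
  (mat2 a b c d 0 0 = a) * (mat2 a b c d 0 1 = b) *
  (mat2 a b c d 1 0 = c) * (mat2 a b c d 1 1 = d).
Proof. by rewrite !mxE. Qed.

Lemma eq_mat2 (K : Type) (A B : 'M[K]_2) :
  A 0 0 = B 0 0 -> A 0 1 = B 0 1 -> A 1 0 = B 1 0 -> A 1 1 = B 1 1 -> A = B.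
Proof.
by move=> h1 h2 h3 h4; rewrite [A]mat2E [B]mat2E h1 h2 h3 h4.
Qed.

Lemma mulmx2E (K : pzSemiRingType) (A B : 'M[K]_2) i j :
  (A *m B) i j = A i 0 * B 0 j + A i 1 * B 1 j.
Proof. by rewrite mxE big_ord_recl big_ord1; congr (_ * _ + A i _ * B _ _); apply/val_inj. Qed.

Lemma mulmx_mat2 (K : pzSemiRingType) (a b c d a' b' c' d' : K) :
  mat2 a b c d *m mat2 a' b' c' d'
  = mat2 (a * a' + b * c') (a * b' + b * d') (c * a' + d * c') (c * b' + d * d').
Proof. by apply: eq_mat2; rewrite mulmx2E !mat2_entries. Qed.

Lemma add_mat2 (K : nmodType) (a b c d a' b' c' d' : K) :
  mat2 a b c d + mat2 a' b' c' d' = mat2 (a + a') (b + b') (c + c') (d + d').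
Proof. by apply: eq_mat2; rewrite [LHS]mxE !mat2_entries. Qed.

(** [mat2 x (x * y) 1 y] is the column (x, 1) times the row (1, y). The hypotheses say that the
    transition matrix sends the column (x, 1) to [mu] times (x', 1) and the row (1, y') to [nu]
    times (1, y), so both products are multiples of one matrix. Pairing the row (1, y') with the
    column (x, 1) through the transition matrix in two ways gives [hs], which matches the
    factors. *)
Lemma rank_one_lax (F : fieldType) (x x' y y' u t c : F) :
  u != 0 -> x + y != 0 -> x' + y' != 0 ->
  x + u = (t * x / u + 1) * x' -> u + y' = (1 + y' * t / u) * y ->
  (c / (x' + y')) *: (mat2 x' (x' * y') 1 y' *m mat2 1 u (t / u) 1)
  = (c / (x + y)) *: (mat2 1 u (t / u) 1 *m mat2 x (x * y) 1 y).
Proof.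
move=> u0 s0 s0' hx hy.
set mu := _ + 1 in hx; set nu := 1 + _ in hy.
have hs : nu * (x + y) = mu * (x' + y').
  by rewrite !mulrDr -hx -hy /mu /nu; field.
have -> : mat2 x' (x' * y') 1 y' *m mat2 1 u (t / u) 1
          = nu *: mat2 x' (x' * y) 1 y.
  apply: eq_mat2; rewrite mulmx2E [in RHS]mxE !mat2_entries.
  - by rewrite /nu; field.
  - by rewrite mulrCA -hy; ring.
  - by rewrite /nu; field.
  - by rewrite -hy; ring.
have -> : mat2 1 u (t / u) 1 *m mat2 x (x * y) 1 y
          = mu *: mat2 x' (x' * y) 1 y.
  apply: eq_mat2; rewrite mulmx2E [in RHS]mxE !mat2_entries.
  - by rewrite -hx; ring.
  - by rewrite [RHS]mulrA -hx; ring.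
  - by rewrite /mu; field.
  - by rewrite /mu; field.
rewrite !scalerA; congr (_ *: _); apply: (mulIf s0'); apply: (mulIf s0).
transitivity (c * (nu * (x + y))); first by field; rewrite s0'.
by rewrite hs; field; rewrite s0.
Qed.

(** * Cross-ratio nets on an abstract octant *)

Section OctantNet.

Variables (F : numFieldType) (V : zmodType) (I : finType) (e : I -> V).
Variables (w : I -> V -> F) (T : I -> F) (a : F) (Z : V -> F).

Definition octant (n : V) : Prop := exists k : I -> nat, n = \sum_i e i *+ k i.

(** [w i] plays the coordinate along [e i], and [T i] the square of theta_i. The octant is abstract
    so that one argument serves every sheet; [w] is given by its value at 0 and its increments, so
    it can absorb the sign of a reversed unit vector. *)
Record octant_net : Prop := OctantNet {
  net_T_neq0 : forall i, T i != 0;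
  net_T_inj : injective T;
  net_w_origin : forall i, w i 0 = 0;
  net_w_shift : forall i j n, w i (n + e j) = w i n + (i == j)%:R;
  net_Z_origin : Z 0 = 0;
  net_Z_axis : forall i k, (0 < k)%N ->
    k%:R * ((Z (e i *+ k.+1) - Z (e i *+ k)) * (Z (e i *+ k) - Z (e i *+ k.-1))
            / (Z (e i *+ k.+1) - Z (e i *+ k.-1))) = a * Z (e i *+ k);
  net_Z_cross_ratio : forall j k n, octant n -> j != k ->
    ((Z n - Z (n + e j)) * (Z (n + e j + e k) - Z (n + e k)))
    / ((Z (n + e j) - Z (n + e j + e k)) * (Z (n + e k) - Z n)) = T j / T k;
  net_Z_nondeg : forall i n, octant n ->
    Z (n + e i) != Z n /\ Z (n + e i + e i) != Z n }.

Hypothesis net : octant_net.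

Let T_neq0 := net_T_neq0 net.
Let T_inj := net_T_inj net.
Let w_origin := net_w_origin net.
Let w_shift := net_w_shift net.
Let Z_origin := net_Z_origin net.
Let Z_axis := net_Z_axis net.
Let Z_cross_ratio := net_Z_cross_ratio net.
Let Z_nondeg := net_Z_nondeg net.

Lemma octant0 : octant 0.
Proof. by exists (fun=> 0%N); rewrite big1. Qed.

Lemma octantD i n : octant n -> octant (n + e i).
Proof.
move=> [k ->]; exists (fun j => (k j + (j == i))%N).
rewrite [RHS](eq_bigr (fun j => e j *+ k j + e j *+ (j == i))); last first.
  by move=> j _; rewrite mulrnDr.
rewrite big_split /=; congr (_ + _).
by rewrite (bigD1 i) //= eqxx mulr1n big1 ?addr0 // => j /negbTE ->.
Qed.

Lemma w_shiftMn i j n k : w i (n + e j *+ k) = w i n + (k * (i == j))%:R.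
Proof.
elim: k => [|k IH]; first by rewrite mulr0n !addr0.
by rewrite mulrSr addrA w_shift IH -addrA -natrD mulSn addnC.
Qed.

(** Since [w] reads off the multiplicities, a nonzero [w i n] permits a step back along [e i] inside
    the octant. *)
Lemma w_coord i (k : I -> nat) : w i (\sum_j e j *+ k j) = (k i)%:R.
Proof.
have main (r : seq I) : w i (\sum_(j <- r) e j *+ k j)
    = (\sum_(j <- r) k j * (i == j))%:R.
  elim: r => [|j r IH]; first by rewrite !big_nil w_origin.
  by rewrite !big_cons addrC w_shiftMn IH -natrD addnC.
rewrite main (bigD1 i) //= eqxx muln1 big1 ?addn0 // => j /negbTE.
by rewrite eq_sym => ->; rewrite muln0.
Qed.

Lemma sum_pred (k : I -> nat) i : (0 < k i)%N ->
  \sum_j e j *+ (k j - (j == i)) = \sum_j e j *+ k j - e i.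
Proof.
move=> ki; rewrite (bigD1 i) //= [in RHS](bigD1 i) //= eqxx subn1.
have -> : e i *+ k i = e i *+ (k i).-1 + e i by rewrite -mulrSr prednK.
rewrite [in RHS]addrAC addrK; congr (_ + _).
by apply: eq_bigr => j /negbTE ->; rewrite subn0.
Qed.

Lemma octantB i n : octant n -> w i n != 0 -> octant (n - e i).
Proof.
move=> [k ->]; rewrite w_coord pnatr_eq0 -lt0n => ki.
by exists (fun j => (k j - (j == i))%N); rewrite sum_pred.
Qed.

(** * Transition matrices and their action on the residues *)

Definition lax i n (l : F) : 'M[F]_2 :=
  let u := Z n - Z (n + e i) in mat2 1 u (l * T i * u^-1) 1.

Definition resid0 n : 'M[F]_2 := mat2 (- (a / 2)) (- (a * Z n)) 0 (a / 2).

Definition resid i n : 'M[F]_2 :=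
  let zp := Z (n + e i) in let zm := Z (n - e i) in
  (w i n / (zp - zm)) *: mat2 (zp - Z n) ((zp - Z n) * (Z n - zm)) 1 (Z n - zm).

Definition E21 : 'M[F]_2 := mat2 0 0 1 0.

(** The derivative of [lax i n l] in l, which is constant. *)
Definition dlax i n : 'M[F]_2 := (T i / (Z n - Z (n + e i))) *: E21.

Lemma laxB i n l q : lax i n l = lax i n q + (l - q) *: dlax i n.
Proof. by apply: eq_mat2; rewrite !(mxE, mat2_entries) /=; ring. Qed.

Lemma edge_neq0 i n : octant n -> Z n - Z (n + e i) != 0.
Proof. by move=> on; rewrite subr_eq0 eq_sym; case: (Z_nondeg i on). Qed.

(** At l = 0 the transition matrix is upper unipotent, and conjugation by it moves the off-diagonal
    entry by a times the edge difference. *)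
Lemma resid0_lax i n : octant n ->
  resid0 (n + e i) *m lax i n 0 = lax i n 0 *m resid0 n.
Proof. 
by move=> on; apply: eq_mat2; rewrite !mulmx2E !mat2_entries; field; rewrite ?edge_neq0.
Qed.

(** At l = 1 / T i the transition matrix is singular: it kills the column factor of [resid i n] and
    is killed by the row factor of [resid i (n + e i)]. Both sides are 0. *)
Lemma resid_lax_eq i n : octant n ->
  resid i (n + e i) *m lax i n (T i)^-1 = lax i n (T i)^-1 *m resid i n.
Proof.
move=> on; have u0 := edge_neq0 i on; rewrite /resid addrK.
rewrite -scalemxAl -scalemxAr /lax mulVf //.
have -> : mat2 (Z (n + e i + e i) - Z (n + e i))
  ((Z (n + e i + e i) - Z (n + e i)) * (Z (n + e i) - Z n)) 1 (Z (n + e i) - Z n)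
  *m mat2 1 (Z n - Z (n + e i)) (1 * (Z n - Z (n + e i))^-1) 1 = 0.
  by apply: eq_mat2; rewrite !mulmx2E !mat2_entries !mxE; field.
have -> : mat2 1 (Z n - Z (n + e i)) (1 * (Z n - Z (n + e i))^-1) 1 *m 
  mat2 (Z (n + e i) - Z n) ((Z (n + e i) - Z n) * (Z n - Z (n - e i))) 1 (Z n - Z (n - e i)) = 0.
  by apply: eq_mat2; rewrite !mulmx2E !mat2_entries !mxE; field.
by rewrite !scaler0.
Qed.

Lemma resid_w0 i n : w i n = 0 -> resid i n = 0.
Proof. by move=> h; rewrite /resid h mul0r scale0r. Qed.

(** The cross-ratio equations of the squares at n and at n - e l become the column and the row
    hypothesis of [rank_one_lax], respectively. *)
Lemma resid_lax_neq i l n : octant n -> l != i ->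
  resid l (n + e i) *m lax i n (T l)^-1 = lax i n (T l)^-1 *m resid l n.
Proof.
move=> on li; have wE : w l (n + e i) = w l n.
  by rewrite w_shift (negbTE li) addr0.
(* When [w l n] is 0, n - e l may lie outside the octant, but both residues carry this factor and
   vanish. *)
have [w0|w0] := eqVneq (w l n) 0.
  by rewrite !resid_w0 ?wE // mul0mx mulmx0.
have op := octantB on w0; set p := n - e l in op.
have pE : p + e l = n by rewrite /p subrK.
have [_ zpzm0] := Z_nondeg l op; rewrite pE in zpzm0.
have [_ zpzm0'] := Z_nondeg l (octantD i op).
have nE : p + e i + e l = n + e i by rewrite addrAC pE.
rewrite nE in zpzm0'.
have := Z_cross_ratio on li; have := Z_cross_ratio op li.
rewrite pE addrAC [n + e l + e i]addrAC.
have := edge_neq0 i on; have := edge_neq0 l (octantD i on).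
have := edge_neq0 l on; have := edge_neq0 l (octantD i op).
have := edge_neq0 l op; have := edge_neq0 i op; rewrite nE pE.
have pie : n + e i - e l = p + e i by rewrite /p addrAC.
rewrite /resid /lax wE pie -/p -scalemxAl -scalemxAr.
move: zpzm0 zpzm0'.
set z := Z n; set zi := Z (n + e i); set zp := Z (n + e l).
set zpi := Z (n + e i + e l); set zm := Z p; set zmi := Z (p + e i).
rewrite -subr_eq0 -[zpi == _]subr_eq0 => d0 d0' h1 h2 h3 h4 h5 h6 cr2 cr1.
have t1 : T i / T l = ((zp - zpi) * (zi - z)) / ((z - zp) * (zpi - zi)).
  by rewrite -invf_div -cr1 invf_div.
have t2 : T i / T l = ((z - zi) * (zmi - zm)) / ((zm - z) * (zi - zmi)).
  by rewrite -invf_div -cr2 invf_div.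
have -> : (T l)^-1 * T i * (z - zi)^-1 = (T i / T l) / (z - zi).
  by rewrite [_ * T i]mulrC.
have -> : zp - zm = (zp - z) + (z - zm) by ring.
have -> : zpi - zmi = (zpi - zi) + (zi - zmi) by ring.
apply: rank_one_lax => //.
- by have -> : (zp - z) + (z - zm) = zp - zm by ring.
- by have -> : (zpi - zi) + (zi - zmi) = zpi - zmi by ring.
- rewrite t1; field.
  by rewrite h6 h4 -opprB oppr_eq0 h5.
- rewrite t2; field.
  by rewrite h6 h2 -opprB oppr_eq0 h3.
Qed.

(** * The monodromy matrix, its defect, and propagation across a square *)

Definition monodromy n l : 'M[F]_2 :=
  l^-1 *: resid0 n + \sum_i (l - (T i)^-1)^-1 *: resid i n.

Definition resid_sum n : 'M[F]_2 := resid0 n + \sum_i resid i n.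

(** Equality at q cancels the pole, and since [lax] is affine in l, what remains is independent of
    l. *)
Lemma pole_lax i n l q (A B : 'M[F]_2) : l != q ->
  A *m lax i n q = lax i n q *m B ->
  ((l - q)^-1 *: A) *m lax i n l - lax i n l *m ((l - q)^-1 *: B)
  = A *m dlax i n - dlax i n *m B.
Proof.
rewrite -subr_eq0 => lq AB; rewrite -scalemxAl -scalemxAr -scalerBr.
rewrite (laxB i n l q) mulmxDr mulmxDl AB opprD addrACA subrr add0r.
by rewrite -scalemxAr -scalemxAl -scalerBr scalerA mulVf // scale1r.
Qed.

(* All residues of the left-hand side vanish, and it is bounded at infinity. *)
Lemma monodromy_defect i n l : octant n -> l != 0 ->
  (forall j, l != (T j)^-1) ->
  monodromy (n + e i) l *m lax i n l - lax i n l *m monodromy n l - dlax i n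
  = (T i / (Z n - Z (n + e i))) *:
    (resid_sum (n + e i) *m E21 - E21 *m resid_sum n - E21).
Proof.
move=> on l0 lT.
transitivity (resid_sum (n + e i) *m dlax i n - dlax i n *m resid_sum n
              - dlax i n); last first.
  by rewrite /dlax -scalemxAr -scalemxAl !scalerBr.
congr (_ - _); rewrite /monodromy /resid_sum.
rewrite !mulmxDl !mulmxDr !opprD; rewrite addrACA [RHS]addrACA; congr (_ + _).
  by rewrite -[l in l^-1]subr0; apply: pole_lax => //; apply: resid0_lax.
rewrite !mulmx_suml !mulmx_sumr -!sumrB; apply: eq_bigr => j _.
apply: pole_lax => //; have [->|ji] := eqVneq j i.
  exact: resid_lax_eq.
exact: resid_lax_neq.
Qed.

(** By [E21_commutator] the defect along [e i] consists, up to sign and a common factor, of the (0,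
    1) entries of the residue sums at n + e i and at n, and of one relation between their diagonals:
    [constraint] at the two ends, and [transfer]. *)
Definition constraint n : Prop := resid_sum n 0 1 = 0.

Definition transfer i n : Prop :=
  resid_sum (n + e i) 1 1 = resid_sum n 0 0 + 1.

Lemma constraintE n : constraint n <->
  \sum_i w i n * ((Z (n + e i) - Z n) * (Z n - Z (n - e i))
                  / (Z (n + e i) - Z (n - e i))) = a * Z n.
Proof.
have -> : \sum_i w i n * ((Z (n + e i) - Z n) * (Z n - Z (n - e i))
                  / (Z (n + e i) - Z (n - e i)))
          = resid_sum n 0 1 + a * Z n.
  rewrite /resid_sum mxE summxE mat2_entries addrAC addNr add0r.
  by apply: eq_bigr => i _; rewrite mxE mat2_entries; ring.
rewrite /constraint; split=> [->|]; first by rewrite add0r.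
by move/eqP; rewrite -subr_eq0 addrK => /eqP.
Qed.

Lemma E21_commutator (A B : 'M[F]_2) :
  A *m E21 - E21 *m B - E21
  = mat2 (A 0 1) 0 (A 1 1 - B 0 0 - 1) (- B 0 1).
Proof.
have subE (X Y : 'M[F]_2) i j : (X - Y) i j = X i j - Y i j by rewrite !mxE.
by apply: eq_mat2; rewrite !subE !mulmx2E !mat2_entries; ring.
Qed.

Lemma monodromy_lax i n l : octant n -> l != 0 -> (forall j, l != (T j)^-1) ->
  constraint n -> constraint (n + e i) -> transfer i n ->
  monodromy (n + e i) l *m lax i n l = dlax i n + lax i n l *m monodromy n l.
Proof.
move=> on l0 lT cn cn' tn; have := monodromy_defect i on l0 lT.
rewrite E21_commutator (cn : _ = _) (cn' : _ = _) (tn : _ = _).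
have -> : mat2 0 0 (resid_sum n 0 0 + 1 - resid_sum n 0 0 - 1) (- 0)
          = 0 :> 'M[F]_2.
  by apply: eq_mat2; rewrite mat2_entries [RHS]mxE //; ring.
by rewrite scaler0 -addrA -opprD => /subr0_eq ->; rewrite addrC.
Qed.

(** The first equation is the cross-ratio equation of the square at n in matrix form; the second is
    its derivative in l. *)
Lemma lax_zero_curvature i j n l : octant n -> j != i ->
  lax i (n + e j) l *m lax j n l = lax j (n + e i) l *m lax i n l
  /\ dlax i (n + e j) *m lax j n l + lax i (n + e j) l *m dlax j n
     = dlax j (n + e i) *m lax i n l + lax j (n + e i) l *m dlax i n.
Proof.
move=> on ji; have := Z_cross_ratio on ji; rewrite /lax /dlax [n + e i + e j]addrAC.
have := edge_neq0 j (octantD i on); rewrite [n + e i + e j]addrAC.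
have := edge_neq0 i (octantD j on); have := edge_neq0 i on.
have := edge_neq0 j on.
set z := Z n; set zi := Z (n + e i); set zj := Z (n + e j).
set zij := Z (n + e j + e i) => h1 h2 h3 h4 cr.
have -> : T j = T i * (((z - zj) * (zij - zi)) / ((zj - zij) * (zi - z))).
  by rewrite cr mulrC divfK.
have h2' : zi - z != 0 by rewrite -opprB oppr_eq0.
have E21Z c : c *: E21 = mat2 0 0 c 0 :> 'M[F]_2.
  by apply: eq_mat2; rewrite [LHS]mxE !mat2_entries ?mulr0 ?mulr1.
rewrite !E21Z !mulmx_mat2 !add_mat2; split; congr mat2; field;
  by rewrite ?h1 ?h2 ?h2' ?h3 ?h4.
Qed.

(** Coinciding ends would make the cross-ratio 1, against the injectivity of [T]. *)
Lemma edge_ends_neq i j n : octant n -> j != i -> Z (n + e j) != Z (n + e i).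
Proof.
move=> on ji; apply/eqP => zji.
have := Z_cross_ratio on ji; have := edge_neq0 i (octantD j on).
have := edge_neq0 i on; rewrite -zji => h1 h2.
have -> : (Z n - Z (n + e j)) * (Z (n + e j + e i) - Z (n + e j))
  / ((Z (n + e j) - Z (n + e j + e i)) * (Z (n + e j) - Z n)) = 1.
  by field; rewrite h2 -opprB oppr_eq0 h1.
move=> /esym /divr1_eq /T_inj jiE; by rewrite jiE eqxx in ji.
Qed.

(** The defect does not depend on l, so a single point off the poles suffices to test it; the one
    chosen exceeds every pole in modulus. *)
Lemma exists_regular_point : exists l : F, l != 0 /\ forall j, l != (T j)^-1.
Proof.
have s0 : 0 <= \sum_j `|(T j)^-1| by apply: sumr_ge0 => j _.
have s1 : 0 < 1 + \sum_j `|(T j)^-1| by rewrite ltr_wpDr.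
exists (1 + \sum_j `|(T j)^-1|); split=> [|j]; first by rewrite gt_eqF.
apply/eqP => h; have : 1 + \sum_j `|(T j)^-1| <= \sum_j `|(T j)^-1|.
  rewrite -[leLHS]gtr0_norm // {1}h [leRHS](bigD1 j) //= lerDl.
  exact: sumr_ge0.
by rewrite gerDr ler10.
Qed.

(* Both routes from [o] to the opposite vertex give the same matrix there; the
   two defects therefore agree after multiplication by the transition matrices
   at [o], and since [Z (o + e j) != Z (o + e i)] they both vanish. *)
Lemma constraint_step i j o : octant o -> j != i ->
  constraint o -> constraint (o + e i) -> constraint (o + e j) ->
  transfer i o -> transfer j o ->
  constraint (o + e j + e i) /\ transfer i (o + e j).
Proof.
move=> oo ji co ci cj ti tj; have [l [l0 lT]] := exists_regular_point.
have [zc dzc] := lax_zero_curvature l oo ji.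
have Dj := monodromy_lax oo l0 lT co cj tj.
have Di := monodromy_lax oo l0 lT co ci ti.
have := monodromy_defect i (octantD j oo) l0 lT.
have := monodromy_defect j (octantD i oo) l0 lT.
(* The constraints at o + e i and o + e j clear the second columns of the two defects. *)
rewrite !E21_commutator (ci : _ = _) (cj : _ = _) oppr0 [_ + e i + e j]addrAC.
rewrite /constraint /transfer.
set n := o + e j + e i; set x := resid_sum n 0 1.
set y := _ - 1; set c := _ / _ => defj.
set y' := _ - 1; set c' := _ / _ => defi.
have c'0 : c' != 0.
  by rewrite mulf_neq0 ?invr_eq0 ?T_neq0 // edge_neq0 //; apply: octantD.
have uv : (Z o - Z (o + e j)) - (Z o - Z (o + e i)) != 0.
  by rewrite opprB addrC addrA subrK subr_eq0 eq_sym; apply: edge_ends_neq.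
(* Once the first edge satisfies the recurrence, the defect of the second edge times [L0] depends
   only on the end matrices and on [L1 *m L0] with its derivative, which are the same for both
   routes. *)
have two_edges (A0 A1 A2 L0 L1 D0 D1 : 'M[F]_2) :
    A1 *m L0 = D0 + L0 *m A0 ->
    (A2 *m L1 - L1 *m A1 - D1) *m L0
    = A2 *m (L1 *m L0) - (L1 *m L0) *m A0 - (D1 *m L0 + L1 *m D0).
  move=> h; rewrite !mulmxBl -!mulmxA h mulmxDr !opprD -!addrA.
  by congr (_ + _); rewrite [LHS]addrC addrA.
have defE : (c' *: mat2 x 0 y' 0) *m lax j o l = (c *: mat2 x 0 y 0) *m lax i o l.
  by rewrite -defi -defj (two_edges _ _ _ _ _ _ _ Dj) (two_edges _ _ _ _ _ _ _ Di) zc dzc.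
(* The first row of [lax] is 1 and the edge difference, so the two columns of [defE] supply the two
   hypotheses; [uv] separates the edge differences. *)
have kill s t : c' * s = c * t ->
   c' * s * (Z o - Z (o + e j)) = c * t * (Z o - Z (o + e i)) -> s = 0.
  move=> <- /eqP; rewrite -subr_eq0 -mulrBr mulf_eq0 (negPf uv) orbF mulf_eq0.
  by rewrite (negPf c'0) => /eqP.
move: defE; rewrite -!scalemxAl !mulmx_mat2 => defE.
have en i' j' := congr1 (fun A : 'M[F]_2 => A i' j') defE.
have x0 : x = 0.
  apply: (kill x x); [move: (en 0 0)|move: (en 0 1)];
  by rewrite [LHS]mxE [RHS]mxE !mat2_entries ?mul0r ?addr0 ?mulr1 ?mulrA.
have y0 : y' = 0.
  apply: (kill y' y); [move: (en 1 0)|move: (en 1 1)];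
  by rewrite [LHS]mxE [RHS]mxE !mat2_entries ?mul0r ?addr0 ?mulr1 ?mulrA.
split=> //; move: y0; rewrite /y' => /eqP.
by rewrite subr_eq0 subr_eq addrC => /eqP.
Qed.

(** * The semi-axes, and induction over the octant *)

Lemma octant_axis i k : octant (e i *+ k).
Proof.
by elim: k => [|k IH]; rewrite ?mulrSr; [exact: octant0|exact: octantD].
Qed.

Lemma w_axis j i k : w j (e i *+ k) = (k * (j == i))%:R.
Proof. by rewrite -[e i *+ k]add0r w_shiftMn w_origin add0r. Qed.

Lemma resid_sum_axis i k :
  resid_sum (e i *+ k) = resid0 (e i *+ k) + resid i (e i *+ k).
Proof.
rewrite /resid_sum (bigD1 i) //= big1 ?addr0 // => j /negbTE ji.
by rewrite resid_w0 // w_axis ji muln0.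
Qed.

Lemma axis_predE i k : (0 < k)%N -> e i *+ k - e i = e i *+ k.-1.
Proof. by case: k => // k _; rewrite mulrSr addrK. Qed.

Lemma constraint_axis i k : constraint (e i *+ k).
Proof.
rewrite /constraint resid_sum_axis mxE mat2_entries [X in _ + X]mxE mat2_entries.
rewrite -mulrSr w_axis eqxx muln1.
case: k => [|k]; first by rewrite mulr0n Z_origin mulr0 !mul0r oppr0 addr0.
by rewrite -(Z_axis i (ltn0Sn k)) axis_predE //=; ring.
Qed.

(** After multiplication by [z1 - z0] the claim is the difference of the axis equations at k + 1 and
    at k, rewritten as [hX] and [hY]. *)
Lemma transfer_axis i k : transfer i (e i *+ k).
Proof.
have [d0 d1] := Z_nondeg i (octant_axis i k).
rewrite /transfer -mulrSr !resid_sum_axis.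
rewrite mxE mat2_entries [X in _ + X]mxE mat2_entries -mulrSr.
rewrite [in RHS]mxE mat2_entries [X in _ + X + 1]mxE mat2_entries -mulrSr.
rewrite !w_axis eqxx !muln1 axis_predE //=.
rewrite -!mulrSr in d0 d1.
have := Z_axis i (ltn0Sn k); rewrite /=.
set z0 := Z (e i *+ k); set z1 := Z (e i *+ k.+1); set z2 := Z (e i *+ k.+2).
set X := _ / _ * (z1 - z0) => ax.
set Y := _ / _ * (z1 - z0).
have s0 : z1 - z0 != 0 by rewrite subr_eq0.
have hX : (k.+1%:R - X) * (z1 - z0) = a * z1.
  by rewrite -ax /X; field; rewrite subr_eq0.
have hY : (k%:R - Y) * (z1 - z0) = a * z0.
  (* At k = 0 there is no axis equation; both sides vanish because the coordinate and [Z 0] are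
     0. *)
  rewrite /Y; have [k0|k0] := posnP k.
    by rewrite /z0 k0 mulr0n Z_origin; ring.
  rewrite axis_predE // -(Z_axis i k0) -/z0 -/z1; field.
  have [_] := Z_nondeg i (octant_axis i k.-1).
  by rewrite -!mulrSr prednK // subr_eq0.
apply: (mulIf s0); apply/eqP; rewrite -subr_eq0; apply/eqP.
transitivity (a * (z1 - z0) - (k.+1%:R - X) * (z1 - z0)
              + (k%:R - Y) * (z1 - z0)); last by rewrite hX hY; ring.
by rewrite -addn1 natrD; field.
Qed.

(** Induction on the sum of the multiplicities. Off the axis of [e i], n = p + e j with j different
    from i, and the statement at p, which covers the neighbours of p, is what [constraint_step]
    needs on the square at p. *)
Lemma octant_constraint_transfer n : octant n ->
  constraint n /\ forall i, constraint (n + e i) /\ transfer i n.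
Proof.
move=> [k ->{n}]; have [N] := ubnP (\sum_i k i).
elim: N k => // N IH k kN; set n := \sum_i _.
have back j : (0 < k j)%N -> exists2 p, n = p + e j &
    octant p /\ (constraint p /\ forall i, constraint (p + e i) /\ transfer i p).
  move=> kj; exists (n - e j); first by rewrite subrK.
  rewrite -sum_pred //; split; first by exists (fun i => (k i - (i == j))%N).
  rewrite ltnS in kN; apply: IH; apply: leq_trans kN.
  apply: leq_ltn_trans (_ : \sum_(i | i != j) k i + (k j).-1 < _)%N.
    rewrite (bigD1 j) //= eqxx subn1 addnC leq_add2r.
    by apply: leq_sum => i _; apply: leq_subr.
  by rewrite [X in (_ < X)%N](bigD1 j) //= addnC ltn_add2r prednK.
split=> [|i].
  have [k0|] := boolP [forall j, k j == 0%N].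
    rewrite /n big1 => [|j _]; last by rewrite (eqP (forallP k0 j)) mulr0n.
    apply/constraintE; rewrite Z_origin mulr0 big1 // => j _.
    by rewrite w_origin mul0r.
  rewrite negb_forall => /existsP [j]; rewrite -lt0n => /back [p -> [_ [_ co]]].
  by case: (co j).
have [k0|] := boolP [forall (j | j != i), k j == 0%N].
  have -> : n = e i *+ k i.
    rewrite /n (bigD1 i) //= big1 ?addr0 // => j ji.
    by rewrite (eqP (forall_inP k0 j ji)) mulr0n.
  by rewrite -mulrSr; split; [exact: constraint_axis|exact: transfer_axis].
rewrite negb_forall_in => /exists_inP [j ji]; rewrite -lt0n => /back [p -> [op [co oi]]].
have [ci ti] := oi i; have [cj tj] := oi j.
exact: constraint_step.
Qed.

Lemma octant_monodromy i n l : octant n -> l != 0 -> (forall j, l != (T j)^-1) ->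
  monodromy (n + e i) l *m lax i n l = dlax i n + lax i n l *m monodromy n l.
Proof.
move=> on l0 lT; have [cn /(_ i) [cn' tn]] := octant_constraint_transfer on.
exact: monodromy_lax.
Qed.

End OctantNet.

(** * Pole orders of sums of simple poles *)

Section SimplePoles.

Lemma differentiable_subr_cst (K : numFieldType) (q x : K^o) :
  differentiable (fun l : K^o => l - q : K^o) x.
Proof. by apply: differentiableB; [exact: ex_diff|exact: differentiable_cst]. Qed.

Lemma near_neq (K : numFieldType) (p c : K^o) : p != c -> \forall l \near p, l != c.
Proof.
move=> pc; have h : \forall l \near p, l - c != 0.
  apply: cvgr_neq0 (differentiable_continuous (differentiable_subr_cst c p)) _.
  by rewrite subr_eq0.
by apply: filterS h => l; rewrite subr_eq0.
Qed.

Lemma near_punctured_neq (K : numFieldType) (p c : K^o) :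
  \forall l \near p^', l != c.
Proof.
have [->|pc] := eqVneq p c; first exact: nbhs_dnbhs_neq.
exact/nbhs_dnbhs/near_neq.
Qed.

Lemma differentiable_fun_sum (K : numFieldType) (V W : normedModType K)
    (J : Type) (r : seq J) (P : pred J) (f : J -> V -> W) (x : V) :
  (forall j, P j -> differentiable (f j) x) ->
  differentiable (fun y => \sum_(j <- r | P j) f j y) x.
Proof.
move=> df; elim: r => [|j r IH].
  rewrite (_ : (fun _ => _) = cst 0); first exact: differentiable_cst.
  by apply/funext => y; rewrite big_nil.
case Pj: (P j); last first.
  rewrite (_ : (fun _ => _) = (fun y => \sum_(k <- r | P k) f k y)) //.
  by apply/funext => y; rewrite big_cons Pj.
rewrite (_ : (fun _ => _) = f j + (fun y => \sum_(k <- r | P k) f k y)).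
  by apply: differentiableD => //; apply: df.
by apply/funext => y; rewrite big_cons Pj.
Qed.

Lemma differentiable_simple_pole (K : numFieldType) (W : normedModType K)
    (q x : K^o) (M : W) : x != q ->
  differentiable (fun l : K^o => (l - q)^-1 *: M) x.
Proof.
move=> xq; apply: differentiableZl; apply: differentiableV.
  exact: differentiable_subr_cst.
by rewrite subr_eq0.
Qed.

Variables (R : realType) (J : finType) (q : J -> R[i]) (M : J -> 'M[R[i]]_2).

Definition pole_sum (l : R[i]) : 'M[R[i]]_2 := \sum_j (l - q j)^-1 *: M j.

(** A term with zero residue is identically 0, so p may coincide with its node. *)
Lemma pole_sum_order0 (p : R[i]) : (forall j, M j != 0 -> p != q j) ->
  pole_order pole_sum p 0.
Proof.
move=> pq; exists (pole_sum : R[i]^o -> _); split=> //; last first.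
  by near=> l; rewrite expr0 invr1 scale1r.
have : \forall l \near (p : R[i]^o), forall j, M j != 0 -> l != q j.
  apply: (@filter_forall _ _ (fun j (l : R[i]^o) => M j != 0 -> l != q j)
    (nbhs (p : R[i]^o))) => j.
  have [_|Mj] := eqVneq (M j) 0; first by near=> l.
  by near=> l => _; near: l; apply: near_neq; exact: pq.
apply: filterS => l lq; apply: diff_derivable; apply: differentiable_fun_sum => j _.
have [->|Mj] := eqVneq (M j) 0.
  rewrite (_ : (fun _ => _) = cst 0); first exact: differentiable_cst.
  by apply/funext => y; rewrite scaler0.
by apply: differentiable_simple_pole; exact: lq.
Unshelve. all: by end_near. Qed.

Lemma pole_sum_order1 (j : J) : injective q -> M j != 0 ->
  pole_order pole_sum (q j) 1.
Proof.
move=> q_inj Mj.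
(* This is (l - q j) times the sum, with the factor cancelled in term j so that the value at q j is
   [M j]. *)
exists (fun l : R[i]^o =>
  M j + \sum_(k | k != j) ((l - q j) * (l - q k)^-1) *: M k); split.
- have : \forall l \near (q j : R[i]^o), forall k, k != j -> l != q k.
    apply: (@filter_forall _ _ (fun k (l : R[i]^o) => k != j -> l != q k)
      (nbhs (q j : R[i]^o))) => k.
    have [_|kj] := eqVneq k j; first by near=> l.
    near=> l => _; near: l; apply: near_neq; apply: contra_neq kj.
    by move/q_inj.
  apply: filterS => l lq; apply: diff_derivable.
  apply: differentiableD; first exact: differentiable_cst.
  apply: differentiable_fun_sum => k kj; apply: differentiableZl.
  apply: differentiableM; first exact: differentiable_subr_cst.
  by apply: differentiableV; [exact: differentiable_subr_cst|rewrite subr_eq0 lq].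
- move=> _; rewrite big1 ?addr0 // => k _.
  by rewrite subrr mul0r scale0r.
- near=> l; have lq : l - q j != 0.
    by rewrite subr_eq0; near: l; exact: near_punctured_neq.
  rewrite /pole_sum (bigD1 j) //= expr1 scalerDr; congr (_ + _).
  rewrite scaler_sumr; apply: eq_bigr => k _.
  by rewrite scalerA mulKf.
Unshelve. all: by end_near. Qed.

End SimplePoles.

(** * Points of the unit circle and the directions theta_r *)

Lemma expi_neq0 (R : realType) (t : R) : expi t != 0.
Proof.
apply/eqP => -[ct st]; have := cos2Dsin2 t.
by rewrite ct st expr0n addr0 => /esym/eqP; rewrite oner_eq0.
Qed.

(** Equality would give cos (y - x) = 1, hence sin t = 0 for the half-difference t, which lies
    strictly between 0 and pi. *)
Lemma expi_neq (R : realType) (x y : R) : x < y < x + 2 * pi -> expi x != expi y.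
Proof.
move=> /andP[xy yx]; apply/eqP => -[cE sE].
set t := (y - x) / 2; have tE : y - x = t + t by rewrite /t; field.
have := cosB y x; rewrite tE cosD -cE -sE -!expr2 cos2Dsin2 => h.
have : 0 < sin t by apply: sin_gt0_pi; rewrite /t; apply/andP; split; lra.
suff : sin t ^+ 2 = 0 by move/eqP; rewrite sqrf_eq0 => /eqP ->; rewrite ltxx.
by have := cos2Dsin2 t; lra.
Qed.

Section Directions.

Variables (R : realType) (d : nat) (theta : int -> R[i]) (gamma : int -> R).
Hypothesis htheta : directions d theta gamma.

Lemma dir_neq0 r : theta r != 0.
Proof. by rewrite (dir_gamma htheta) expi_neq0. Qed.

Lemma dir_sqr_period r (q : int) : theta (r + q * d%:Z) ^+ 2 = theta r ^+ 2.
Proof.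
have nat_case (s : int) (k : nat) : theta (s + k%:Z * d%:Z) ^+ 2 = theta s ^+ 2.
  elim: k => [|k IH]; first by rewrite mul0r addr0.
  by rewrite intS mulrDl mul1r addrCA addrC (dir_antipodal htheta) sqrrN.
case: q => k; first exact: nat_case.
by rewrite -(nat_case _ k.+1) NegzE mulNr subrK.
Qed.

Lemma dir_inj k l : (k < d.*2)%N -> (l < d.*2)%N -> theta k%:Z = theta l%:Z ->
  k = l.
Proof.
have [alpha [tE incr bnd]] := dir_ccw htheta.
have lt_neq i j : (i < j)%N -> (j < d.*2)%N -> theta i%:Z != theta j%:Z.
  move=> ij jd; have id := ltn_trans ij jd; rewrite !tE //; apply: expi_neq.
  rewrite incr //= (lt_le_trans (bnd _ jd)) // lerD2r.
  by have [->//|i0] := posnP i; apply/ltW/incr.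
move=> kd ld tkl; have [kl|kl|//] := ltngtP k l.
  by move: (lt_neq _ _ kl ld); rewrite tkl eqxx.
by move: (lt_neq _ _ kl kd); rewrite tkl eqxx.
Qed.

(** Equal squares mean theta_i = theta_j or theta_i = - theta_j = theta_(j + d), and the second is
    excluded because i < d. *)
Lemma dir_sqr_inj (i j : 'I_d) : theta i%:Z ^+ 2 = theta j%:Z ^+ 2 -> i = j.
Proof.
have lt2 (k : 'I_d) : (k < d.*2)%N by rewrite -addnn ltn_addr.
move/eqP; rewrite eqf_sqr => /orP[/eqP tij|]; first exact/val_inj/(dir_inj (lt2 i) (lt2 j)).
rewrite -(dir_antipodal htheta) -PoszD => /eqP /dir_inj h.
have := h (lt2 i); rewrite -addnn ltn_add2r => /(_ (ltn_ord j)) ijd.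
by have := ltn_ord i; rewrite ijd ltnNge leq_addl.
Qed.

End Directions.

(** * The octant of index m, with directions labelled by their residue modulo d *)

Section OctantOfIndex.

Variables (d : nat) (m : int) (r : 'I_d -> int).
Hypothesis r_range : forall j, m <= r j < m + d%:Z.
Hypothesis r_mod : forall j, (r j %% d%:Z)%Z = j%:Z.

Lemma index_inj : injective r.
Proof. by move=> i j rij; apply/val_inj; have := r_mod j; rewrite -rij r_mod => -[]. Qed.

Lemma unit_vecE j i :
  unit_vec d (r j) 0 i = (-1) ^ (r j %/ d%:Z)%Z * (j == i)%:R.
Proof.
rewrite mxE r_mod -(inj_eq val_inj) eqz_nat.
by case: eqP; rewrite (mulr1, mulr0).
Qed.

(** The offsets of [r j] from m permute ['I_d], so the two sums differ by a reindexing. *)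
Lemma octant_of_index n : in_octant m n <-> octant (fun j => unit_vec d (r j)) n.
Proof.
have off j : (`|r j - m| < d)%N.
  have /andP[mr rm] := r_range j.
  by rewrite -ltz_nat gez0_abs ?subr_ge0 // ltrBlDl.
pose h j := Ordinal (off j).
have hE j : m + (h j)%:Z = r j.
  by have /andP[mr _] := r_range j; rewrite /= gez0_abs ?subr_ge0 // addrCA subrr addr0.
have h_inj : injective h.
  by move=> i j hij; apply: index_inj; rewrite -!hE hij.
split=> -[c ->].
  exists (fun j => c (h j)); rewrite (reindex_inj h_inj).
  by apply: eq_bigr => j _; rewrite hE.
exists (fun i => c (invF h_inj i)); rewrite [RHS](reindex_inj h_inj).
by apply: eq_bigr => j _; rewrite hE invF_f.
Qed.

Variables (R : realType) (theta : int -> R[i]) (gamma : int -> R) (a : R).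
Variables (z : int -> 'rV[int]_d -> R[i]).
Hypothesis htheta : directions d theta gamma.
Hypothesis hz : discrete_power theta gamma a z.
Hypothesis hnd : nonzero_denominators z.

(** The sign in [w] makes the coordinate grow by 1 along [unit_vec d (r j)], which is plus or minus
    e_j. *)
Lemma discrete_power_net (w : 'I_d -> 'rV[int]_d -> R[i]) :
  (forall j n, w j n = ((-1) ^ (r j %/ d%:Z)%Z * n 0 j)%:~R) ->
  octant_net (fun j => unit_vec d (r j)) w (fun j => theta (r j) ^+ 2) a%:C (z m).
Proof.
move=> wE; split.
- by move=> j; rewrite expf_neq0 // (dir_neq0 htheta).
- have sqrE j : theta (r j) ^+ 2 = theta j%:Z ^+ 2.
    rewrite [in LHS](divz_eq (r j) d%:Z) r_mod addrC.
    exact: (dir_sqr_period htheta).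
  by move=> i j; rewrite !sqrE; apply: (dir_sqr_inj htheta).
- by move=> j; rewrite wE mxE mulr0.
- move=> i j n; rewrite !wE mxE unit_vecE mulrDr intrD eq_sym; congr (_ + _).
  case: eqP => [->|_]; rewrite ?mulr0 // mulr1 expN1r.
  by rewrite -expr2 sqrr_sign.
- exact: (dp_origin hz).
- by move=> i k k0; apply: (dp_axis hz).
- move=> j k n /octant_of_index on jk; apply: (dp_cross_ratio hz) => //.
  by rewrite (inj_eq index_inj).
- by move=> i n /octant_of_index on; apply: hnd.
Qed.

Lemma discrete_power_constraint n : in_octant m n ->
  \sum_(j < d) (n 0 j)%:~R *
    ((z m (n + unit_vec d j%:Z) - z m n) * (z m n - z m (n - unit_vec d j%:Z))
     / (z m (n + unit_vec d j%:Z) - z m (n - unit_vec d j%:Z)))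
  = a%:C * z m n.
Proof.
move=> /octant_of_index on.
pose w j (k : 'rV[int]_d) : R[i] := ((-1) ^ (r j %/ d%:Z)%Z * k 0 j)%:~R.
have net : octant_net (fun j => unit_vec d (r j)) w
  (fun j => theta (r j) ^+ 2) a%:C (z m) by exact: discrete_power_net.
have [/constraintE <- _] := octant_constraint_transfer net on.
apply: eq_bigr => j _; rewrite /w expN1r.
have unit_vec_nat : unit_vec d j%:Z = \row_i (j == i)%:R.
  apply/rowP => i; rewrite !mxE modz_small ?divz_small ?ltz_nat ?ltn_ord //.
  by rewrite expr0z eqz_nat -(inj_eq val_inj); case: eqP.
have -> : unit_vec d (r j) = (-1) ^+ `|(r j %/ d%:Z)%Z|%N *: unit_vec d j%:Z.
  by apply/rowP => i; rewrite unit_vecE unit_vec_nat !mxE expN1r.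
(* Reversing e_j exchanges the values at n + e_j and n - e_j, which changes the sign of the
   fraction; the sign of the coordinate compensates. *)
rewrite -signr_odd; case: (odd _); last by rewrite expr0 scale1r mul1r.
rewrite expr1 scaleN1r opprK mulN1r intrN.
set A := z m (n - _); set B := z m (n + _).
by rewrite -(opprB B A) invrN mulrN mulrNN -[A - _]opprB -[_ - B]opprB mulrNN;
  rewrite [X in _ = _ * (X / _)]mulrC.
Qed.

End OctantOfIndex.

(** * Monodromy matrices of the discrete power on the octant of index 0 *)

Lemma derive1_affine (K : numFieldType) (W : normedModType K) (A M : W) (l : K) :
  (fun x : K => A + x *: M)^`()%classic l = M.
Proof.
rewrite derive1E.
have dA : is_diff (l : K^o) (cst A) (0 : K^o -> W) by exact: is_diff_cst.
have dM : is_diff (l : K^o) ( *:%R^~ M) ( *:%R^~ M) by exact: is_diff_scalel.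
have D := is_diffD dA dM.
have -> : 'D_1 (fun x : K => A + x *: M) l = 'D_1 (cst A + *:%R^~ M : K^o -> W) (l : K^o) by [].
rewrite (deriveE _ (@ex_diff _ _ _ _ _ _ _ D)).
by rewrite (@diff_val _ _ _ _ _ _ _ D) fctE add0r scale1r.
Qed.

Section Monodromy.

Variables (R : realType) (d : nat) (theta : int -> R[i]) (gamma : int -> R).
Variables (a : R) (z : int -> 'rV[int]_d -> R[i]).
Hypothesis htheta : directions d theta gamma.
Hypothesis ha : 0 < a < 1.
Hypothesis hz : discrete_power theta gamma a z.
Hypothesis hnd : nonzero_denominators z.

Let r (j : 'I_d) := j%:Z.
Let e (j : 'I_d) := unit_vec d j%:Z.
Let w (j : 'I_d) (n : 'rV[int]_d) : R[i] := (n 0 j)%:~R.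
Let T (j : 'I_d) := theta j%:Z ^+ 2.

Let r_range j : 0 <= r j < 0 + d%:Z.
Proof. by rewrite /r add0r ltz_nat ltn_ord. Qed.

Let r_mod j : (r j %% d%:Z)%Z = j%:Z.
Proof. by rewrite modz_small // ltz_nat ltn_ord. Qed.

Let octantE n : in_octant 0 n <-> octant e n.
Proof. exact: octant_of_index r_range r_mod n. Qed.

Let net : octant_net e w T a%:C (z 0).
Proof.
apply: (discrete_power_net r_range r_mod htheta hz hnd) => j n.
by rewrite divz_small ?expr0z ?mul1r // ltz_nat ltn_ord.
Qed.

(** [ord0] stands for the pole at 0 and the lift of l for theta_l^-2, so that one sum covers all d +
    1 poles. *)
Definition pole (j : 'I_d.+1) : R[i] :=
  if unlift ord0 j is Some l then theta l%:Z ^- 2 else 0.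

Definition pole_residue (c : R[i]) n (j : 'I_d.+1) : 'M[R[i]]_2 :=
  if unlift ord0 j is Some l then residue (z 0) l n + c%:M
  else residue0 a (z 0) n.

(* Adding a scalar function of l to a solution of the monodromy recurrence
   gives another solution.  For [c = 0] this is the solution of the theorem,
   whose residue at [theta l ^- 2] vanishes where [n 0 l = 0]; for [c = 1] all
   residues are nonzero at all points. *)
Definition shifted_monodromy (c : R[i]) n (l : R[i]) : 'M[R[i]]_2 :=
  pole_sum pole (pole_residue c n) l.

Lemma pole_inj : injective pole.
Proof.
move=> i j; rewrite /pole.
case: (unliftP ord0 i) => [i' ->|->]; case: (unliftP ord0 j) => [j' ->|->] //.
- by move=> /invr_inj /(net_T_inj net) ->.
- move=> /eqP; rewrite invr_eq0 => h.
  by have := net_T_neq0 net i'; rewrite /T h.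
- move=> /esym/eqP; rewrite invr_eq0 => h.
  by have := net_T_neq0 net j'; rewrite /T h.
Qed.

Lemma shifted_monodromyE c n l :
  shifted_monodromy c n l = monodromy e w T a%:C (z 0) n l
    + (\sum_(j < d) c * (l - theta j%:Z ^- 2)^-1)%:M.
Proof.
rewrite /shifted_monodromy /pole_sum big_ord_recl /monodromy -addrA.
rewrite /pole /pole_residue unlift_none subr0; congr (_ + _).
rewrite raddf_sum -big_split; apply: eq_bigr => j _.
by rewrite liftK scalerDr scale_scalar_mx [_ * c]mulrC.
Qed.

(** The determinant is 1 - l * T k; the inverse displayed is the adjugate divided by it. *)
Lemma lax_unit k n l : octant e n -> l != (T k)^-1 ->
  lax e T (z 0) k n l \in unitmx.
Proof.
move=> on lT; have u0 := edge_neq0 net k on.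
have Tk := net_T_neq0 net k.
have D0 : 1 - l * T k != 0.
  apply: contra_neq lT => /eqP; rewrite subr_eq0 => /eqP h.
  by apply: (mulIf Tk); rewrite -h mulVf.
suff /mulmx1_unit [] : lax e T (z 0) k n l *m
  (mat2 (1 - l * T k)^-1 (- (z 0 n - z 0 (n + e k)) / (1 - l * T k))
    (- (l * T k / (z 0 n - z 0 (n + e k))) / (1 - l * T k)) (1 - l * T k)^-1)
  = 1%:M by [].
rewrite /lax mulmx_mat2; apply: eq_mat2; rewrite [RHS]mxE mat2_entries /=;
  by field; rewrite ?D0 ?u0.
Qed.

Lemma derive1_transition (k : 'I_d) n (l : R[i]) :
  (transition_mx theta (z 0) k%:Z n)^`()%classic l = dlax e T (z 0) k n.
Proof.
have -> : transition_mx theta (z 0) k%:Z n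
  = fun x => lax e T (z 0) k n 0 + x *: dlax e T (z 0) k n.
  by apply/funext => x; rewrite -[x in RHS]subr0; exact: laxB.
exact: derive1_affine.
Qed.

Lemma shifted_monodromy_system c :
  monodromy_system theta (z 0) (shifted_monodromy c).
Proof.
move=> n k p /octantE on.
have Tnear : \forall l \near p^', forall j, l != (T j)^-1.
  apply: (@filter_forall _ _ (fun j (l : R[i]^o) => l != (T j)^-1) (p^')) => j.
  exact: near_punctured_neq.
have near0 : \forall l \near p^', l != 0 by exact: near_punctured_neq.
apply: filterS2 Tnear near0 => l lT l0 /=.
rewrite derive1_transition.
have Lunit := lax_unit on (lT k).
rewrite -[transition_mx _ _ _ _ _]/(lax e T (z 0) k n l) !shifted_monodromyE.
have := congr1 (mulmx^~ (invmx (lax e T (z 0) k n l)))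
  (octant_monodromy net k on l0 lT).
rewrite mulmxK // => ->; move: (monodromy _ _ _ _ _ n l) => A0.
move: (dlax _ _ _ _ _) => D; rewrite mulmxDr !mulmxDl -addrA.
by rewrite mul_mx_scalar -scalemxAl mulmxV // scalemx1.
Qed.

Lemma residue0_neq0 n : residue0 a (z 0) n != 0.
Proof.
apply/eqP => /(congr1 (fun A : 'M[R[i]]_2 => A 1 1)).
rewrite mat2_entries mxE => /eqP.
rewrite mulf_eq0 invr_eq0 pnatr_eq0 orbF => /eqP [] a0.
by case/andP: ha; rewrite a0 ltxx.
Qed.

(** The prefactor [c] is the (1, 0) entry, which adding the identity leaves unchanged; if it is 0,
    the identity remains. *)
Lemma residueD1_neq0 l n : residue (z 0) l n + 1%:M != 0.
Proof.
rewrite /residue /=; set c := _ / _; have [->|c0] := eqVneq c 0.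
  by rewrite scale0r add0r; exact: oner_neq0.
apply/eqP => /(congr1 (fun A : 'M[R[i]]_2 => A 1 0)).
rewrite mxE [X in X + _]mxE mat2_entries !mxE mulr1 addr0 => /eqP.
by rewrite (negPf c0).
Qed.

Lemma pole_residue1_neq0 n j : pole_residue 1 n j != 0.
Proof.
by rewrite /pole_residue; case: (unlift _ _) => [l|];
  rewrite (residueD1_neq0, residue0_neq0).
Qed.

End Monodromy.

Theorem theorem6p15 (R : realType) (d : nat) (theta : int -> R[i])
    (gamma : int -> R) (a : R) (z : int -> 'rV[int]_d -> R[i])
    (htheta : directions d theta gamma)
    (ha : 0 < a < 1)
    (hz : discrete_power theta gamma a z)
    (hnd : nonzero_denominators z) :
  [/\ isomonodromic theta (z 0),
      exists A : 'rV[int]_d -> R[i] -> 'M[R[i]]_2,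
        monodromy_system theta (z 0) A /\
        forall n : 'rV[int]_d, in_octant 0 n ->
          (forall p : R[i], exists2 k : nat, (k <= 1)%N & pole_order (A n) p k)
          /\
          (forall lambda : R[i],
            lambda != 0 ->
            (forall l : 'I_d, lambda != theta l%:Z ^- 2) ->
            A n lambda = lambda^-1 *: residue0 a (z 0) n
              + \sum_(l < d)
                  (lambda - theta l%:Z ^- 2)^-1 *: residue (z 0) l n)
    & forall (m : int) (n : 'rV[int]_d), in_octant m n ->
        \sum_(j < d) (n 0 j)%:~R *
          ((z m (n + unit_vec d j%:Z) - z m n)
           * (z m n - z m (n - unit_vec d j%:Z))
           / (z m (n + unit_vec d j%:Z) - z m (n - unit_vec d j%:Z)))
        = a%:C * z m n].
Proof.
pose B c := shifted_monodromy theta a z c.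
have Bsys c : monodromy_system theta (z 0) (B c).
  exact: shifted_monodromy_system htheta hz hnd c.
have q_inj : injective (@pole R d theta) by exact: pole_inj htheta hz hnd.
split.
- exists (B 1) => //.
  (* Order 1 at every pole and 0 elsewhere: for c = 1 no residue vanishes at any n. *)
  exists (fun p => [exists j : 'I_d.+1, pole theta j == p] : nat) => n p _ /=.
  have [/existsP [j /eqP <-]|/existsPn pN] := 
      boolP [exists j : 'I_d.+1, pole theta j == p].
    by apply: pole_sum_order1 => //; apply: pole_residue1_neq0.
  by apply: pole_sum_order0 => j _; rewrite eq_sym pN.
(* For c = 0 the residues are the prescribed ones; a point whose residue vanishes gets order 0. *)
- exists (B 0); split=> // n _; split=> [p|l l0 lT].
    have [/existsP [j /andP[/eqP <- Mj]]|/existsPn pN] :=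
      boolP [exists j : 'I_d.+1, (pole theta j == p) && (pole_residue a z 0 n j != 0)].
      by exists 1%N => //; apply: pole_sum_order1.
    exists 0%N => //; apply: pole_sum_order0 => j Mj.
    by have := pN j; rewrite Mj andbT eq_sym.
  rewrite /B shifted_monodromyE big1 => [|j _]; last by rewrite mul0r.
  by rewrite raddf0 addr0.
(* [r j] is the only index in [m, m + d) congruent to j modulo d. *)
- move=> m n; pose r (j : 'I_d) := m + ((j%:Z - m) %% d%:Z)%Z.
  have r_range j : m <= r j < m + d%:Z.
    have d0 : (0 < d)%N by rewrite (leq_trans _ (ltn_ord j)).
    by rewrite lerDl ltrD2l modz_ge0 ?ltz_pmod // eqz_nat -lt0n.
  apply: (discrete_power_constraint (r := r) r_range _ htheta hz hnd) => j.
  by rewrite modzDmr addrC subrK modz_small // ltz_nat ltn_ord.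
Qed.
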